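(* Let $q$ be a prime power and $m,\ell$ positive integers such that $\ell<\frac m2$ and $m_\ell=\frac{m}{(m,\ell)}$ is even. Put $D=q^{(m,\ell)}+1$ and $n=\frac{q^m-1}{D}$. Then $\mathcal{C}_\ell$ is an $[n,m,d]_q$-code with $d=\frac1D q^{\frac m2-1}(q-1)d'$, where $$d'=\begin{cases} q^{\frac m2}-1 & \text{if } \frac12 m_\ell \text{ is even},\\ q^{\frac m2}-q^{(m,\ell)} & \text{if } \frac12 m_\ell\text{ is odd},\end{cases}$$ and $\mathcal{C}_{\ell,0}$ is an $[n,m+1,\hat d]_q$-code with $\hat d=\frac1D\big(q^{m-1}(q-1)-\bar d\big)$, where $$\bar d=\begin{cases} q^{\frac m2+(m,\ell)-1}+1 & \text{if } \frac12 m_\ell \text{ is even},\\ q^{\frac m2+(m,\ell)-1}(q-1) & \text{if } \frac12 m_\ell\text{ is odd}.\end{cases}$$ The weight distributions are as follows (frequencies attached to coinciding weights are to be added). (1) $\mathcal{C}_\ell$: weight $0$ with frequency $1$; weight $\frac1D\{q^m-q^{m-1}+(-1)^{\frac12 m_\ell}(q-1)q^{\frac m2+(m,\ell)-1}\}$ with frequency $n$; weight $\frac1D\{q^m-q^{m-1}+(-1)^{\frac12 m_\ell+1}(q-1)q^{\frac m2-1}\}$ with frequency $nq^{(m,\ell)}$. (2) $\mathcal{C}_{\ell,0}$: all the weights with the frequencies listed in (1), and in addition: weight $\frac{q^m-1}{D}$ with frequency $q-1$; weight $\frac1D\{q^m-q^{m-1}+(-1)^{\frac12 m_\ell+1}q^{\frac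 m2+(m,\ell)-1}-1\}$ with frequency $n(q-1)$; weight $\frac1D\{q^m-q^{m-1}+(-1)^{\frac12 m_\ell}q^{\frac m2-1}-1\}$ with frequency $nq^{(m,\ell)}(q-1)$.
   Context: $(m,\ell)$ denotes the greatest common divisor. Let $\alpha$ be a generator of $\mathbb{F}_{q^m}^*$ and $\mathrm{Tr}_{q^m/q}$ the trace from $\mathbb{F}_{q^m}$ to $\mathbb{F}_q$. With $n=\frac{q^m-1}{q^{(m,\ell)}+1}$ (which equals $\frac{q^m-1}{(q^m-1,q^\ell+1)}$), the cyclic codes are $\mathcal{C}_\ell=\{(\mathrm{Tr}_{q^m/q}(\gamma\alpha^{(q^\ell+1)i}))_{i=0}^{n-1}:\gamma\in\mathbb{F}_{q^m}\}$ and $\mathcal{C}_{\ell,0}=\{(\mathrm{Tr}_{q^m/q}(\gamma\alpha^{(q^\ell+1)i})+b)_{i=0}^{n-1}:\gamma\in\mathbb{F}_{q^m},\ b\in\mathbb{F}_q\}$. An $[n,k,d]_q$-code is a $k$-dimensional linear code in $\mathbb{F}_q^n$ with minimum Hamming distance $d$. The weight of a codeword is its number of nonzero coordinates; the frequency of a weight is the number of codewords with that weight. *)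

(* Defs.v *)
From HB Require Import structures.
From mathcomp Require Import all_boot all_order all_fingroup all_algebra.
From mathcomp Require Import all_solvable all_field.

Set Implicit Arguments.
Unset Strict Implicit.
Unset Printing Implicit Defensive.

Import Order.TTheory GRing.Theory Num.Theory.

Local Open Scope ring_scope.

Section LinearCodes.

Variables (F : finFieldType) (n : nat).
Implicit Types (C : {set 'rV[F]_n}) (u v : 'rV[F]_n).

Definition hamming_dist u v : nat := #|[set i | u 0 i != v 0 i]|.

Definition hamming_weight u : nat := #|[set i | u 0 i != 0]|.

Definition is_min_dist C (d : nat) : Prop :=
  (exists u v, [/\ u \in C, v \in C, u != v & hamming_dist u v = d])
  /\ (forall u v, u \in C -> v \in C -> u != v -> (d <= hamming_dist u v)%N).

Definition is_code C (k d : nat) : Prop :=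
  (exists2 V : {vspace 'rV[F]_n}, C = [set u in V] & \dim V = k)
  /\ is_min_dist C d.

(* [s] is a list of pairs (weight, frequency).  Frequencies of coinciding
   weights are added; since [w] is any rational, a listed weight with nonzero
   total frequency has to be the weight of some codeword, and every weight
   that occurs has to be listed. *)
Definition has_weight_distribution C (s : seq (rat * nat)) : Prop :=
  forall w : rat,
    #|[set u in C | (hamming_weight u)%:R == w]|
      = (\sum_(p <- s | p.1 == w) p.2)%N.

End LinearCodes.

Section Trace.

Variables (F : finFieldType) (L : splittingFieldType F).

(* [galTrace] takes its values in L, inside the line spanned by 1; [Tr] reads
   off the scalar, see [TrE]. *)
Definition Tr (x : L) : F :=
  coord [tuple (1 : L)] ord0 (galTrace 1%AS {:L}%AS x).

Lemma TrE (x : L) : (Tr x)%:A = galTrace 1%AS {:L}%AS x.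
Proof.
pose X := [tuple (1 : L)].
have /coord_span -> : galTrace 1%AS {:L}%AS x \in <<X>>%VS.
  rewrite span_seq1; apply: mem_galTrace (memvf x).
  by apply: finField_galois; apply: sub1v.
by rewrite big_ord1.
Qed.

End Trace.

Section TwoWeightCodes.

Definition code_den (q m l : nat) : nat := (q ^ gcdn m l + 1)%N.

Definition code_len (q m l : nat) : nat := ((q ^ m - 1) %/ code_den q m l)%N.

(* The division defining [code_len] is exact in the case of interest. *)
Lemma code_den_dvd (q m l : nat) :
  ~~ odd (m %/ gcdn m l) -> (code_den q m l %| q ^ m - 1)%N.
Proof.
rewrite /code_den; set e := gcdn m l => ev.
have -> : m = (e * 2 * (m %/ e)./2)%N.
  rewrite -mulnA mul2n even_halfK //.
  by rewrite mulnC divnK // dvdn_gcdl.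
rewrite 2!expnM; apply: (@dvdn_trans ((q ^ e) ^ 2 - 1 ^ 2)%N).
  by rewrite subn_sqr dvdn_mull.
rewrite exp1n -[X in (_ %| _ - X)%N](exp1n (m %/ e)./2).
by rewrite subn_exp dvdn_mulr.
Qed.

Variables (F : finFieldType) (L : splittingFieldType F).

Definition codeword (n l : nat) (a g : L) (b : F) : 'rV[F]_n :=
  \row_(i < n) (Tr (g * a ^+ ((#|F| ^ l + 1) * i)) + b).

(* [finvect_type L] is L itself, seen as a finite type. *)
Definition code_C (n l : nat) (a : L) : {set 'rV[F]_n} :=
  [set codeword n l a g 0 | g : finvect_type L].

Definition code_C0 (n l : nat) (a : L) : {set 'rV[F]_n} :=
  [set codeword n l a g b | g : finvect_type L, b : F].

End TwoWeightCodes.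

Section Formulas.

Variables q m l : nat.

Let Q : rat := q%:R.
Let D : rat := (code_den q m l)%:R.
Let n : nat := code_len q m l.
Let e : nat := gcdn m l.
Let h : nat := m./2.
Let s : nat := (m %/ e)./2.

Definition min_dist_C : rat :=
  D^-1 * Q ^+ (h - 1) * (Q - 1) *
  (if odd s then Q ^+ h - Q ^+ e else Q ^+ h - 1).

Definition min_dist_C0 : rat :=
  D^-1 * (Q ^+ (m - 1) * (Q - 1) -
          (if odd s then Q ^+ (h + e - 1) * (Q - 1)
           else Q ^+ (h + e - 1) + 1)).

Definition weights_C : seq (rat * nat) :=
  [:: (0, 1%N);
      (D^-1 * (Q ^+ m - Q ^+ (m - 1)
               + (-1) ^+ s * (Q - 1) * Q ^+ (h + e - 1)), n);
      (D^-1 * (Q ^+ m - Q ^+ (m - 1)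
               + (-1) ^+ (s + 1) * (Q - 1) * Q ^+ (h - 1)), (n * q ^ e)%N)].

Definition weights_C0 : seq (rat * nat) :=
  weights_C ++
  [:: (D^-1 * (Q ^+ m - 1), (q - 1)%N);
      (D^-1 * (Q ^+ m - Q ^+ (m - 1)
               + (-1) ^+ (s + 1) * Q ^+ (h + e - 1) - 1), (n * (q - 1))%N);
      (D^-1 * (Q ^+ m - Q ^+ (m - 1)
               + (-1) ^+ s * Q ^+ (h - 1) - 1), (n * q ^ e * (q - 1))%N)].

End Formulas.

(* Main.v *)
Require Import Defs.
From HB Require Import structures.
From mathcomp Require Import all_boot all_order all_fingroup all_algebra.
From mathcomp Require Import all_solvable all_field.
From mathcomp Require Import zify ring lra.

Set Implicit Arguments.
Unset Strict Implicit.
Unset Printing Implicit Defensive.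

Import Order.TTheory GRing.Theory Num.Theory.

Local Open Scope ring_scope.

(** Write [q = #|F|], [e = gcd(m, l)], [p = q ^ e], [m = 2 e s], [N = q ^ m]
    and [D = p + 1].

    Because [l / e] is odd and prime to [m / e], the gcd of [q ^ l + 1] and
    [N - 1] is [D] ([gcdn_expn_succ_pred]).  So the first [n = (N - 1) / D]
    powers of [alpha ^ (q ^ l + 1)] list the nonzero [D]-th powers of the big
    field once each, while [x ^ D] takes each of them [D] times.  Hence [D] times
    the weight of a codeword is given by the sizes [A_g(b)] of the fibres of
    [x |-> Tr(g x^D)] ([fibre_cardE], [weight_fibre_card]).

    Nonzero scalars are [D]-th powers, so [A_g(b)] does not depend on [b] as
    long as [b <> 0], and everything is governed by the single integer
    [S_g = A_g(0) - A_g(1)].  As [x ^ D = x ^ p * x], the map is a quadratic form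
    over [F].  Counting the pairs [(x, y)] with [Tr(g x^D) = Tr(g y^D)] in two
    ways gives [S_g ^ 2 = R_g N], where [R_g] is the size of the radical of the
    polar form ([exp_sum_sq]).  For [g <> 0] the radical is zero or a line over
    the subfield with [p ^ 2] elements ([card_radical]), which determines [S_g]
    up to sign.  The sign comes from a congruence, in every characteristic:
    [D] divides [A_g(1)], hence [S_g = 1] modulo [D]; but [- p = 1] modulo [D]
    and [D > 2], so that [S_g] is [(- p) ^ s] or [(- p) ^ (s + 1)]
    ([exp_sum_neq0]).  Finally the [S_g] with [g <> 0] sum to zero, which
    leaves one possibility for how often each value occurs
    ([sum_over_exp_sum]).

    The weights of the codewords are affine in [S_g] ([weightE]), so the
    weight distributions follow, and the minimum distances come from comparing
    a few explicit numbers.  The condition [2 l < m] forces [s >= 2]; this makes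
    the weights of nonzero codewords positive, so that codewords determine
    their parameters and the dimensions are as claimed. *)

(** * Power maps on a finite field *)

Section UnityRoots.

Variables (E : finFieldType) (a : E).
Hypothesis prim_a : #|E|.-1.-primitive_root a.

Lemma generator_primitive_root (u : {unit E}) :
  generator [set: {unit E}] u -> #|E|.-1.-primitive_root (FinRing.uval u).
Proof.
move=> gen_u; have ord_u : #[u]%g = #|E|.-1.
  by rewrite orderE -(eqP gen_u) card_finField_unit.
have E_gt0 : (0 < #|E|.-1)%N by rewrite -ord_u order_gt0.
apply/andP; split=> //; apply/forallP=> i; rewrite unity_rootE.
rewrite -FinRing.val_unitX -FinRing.val_unit1 (inj_eq val_inj).
rewrite -order_dvdn ord_u; apply/eqP; apply/idP/idP=> [dv|/eqP->//].
by rewrite eqn_leq ltn_ord dvdn_leq.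
Qed.

Lemma card_pred_gt0 : (0 < #|E|.-1)%N.
Proof. exact: prim_order_gt0 prim_a. Qed.

Lemma expf_card_pred (x : E) : x != 0 -> x ^+ #|E|.-1 = 1.
Proof.
move=> x0; apply: (mulIf x0); rewrite -exprSr mul1r prednK ?expf_card //.
exact: ltnW (finNzRing_gt1 E).
Qed.

Lemma card_unity_roots d :
  (d %| #|E|.-1)%N -> #|[set x : E | x ^+ d == 1]| = d.
Proof.
move=> d_dv; have prim_z := dvdn_prim_root prim_a d_dv.
set z := a ^+ _ in prim_z.
have -> : [set x : E | x ^+ d == 1] = [set z ^+ i | i : 'I_d].
  apply/setP=> x; rewrite inE; apply/eqP/imsetP=> [xd|[i _ ->]].
    by have [i ->] := prim_rootP prim_z xd; exists i.
  by rewrite exprAC (prim_expr_order prim_z) expr1n.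
rewrite card_imset ?card_ord // => i j /eqP.
rewrite (eq_prim_root_expr prim_z) !modn_small // => /eqP; exact: val_inj.
Qed.

Lemma card_power_fibre d (y : E) : (d %| #|E|.-1)%N -> y != 0 ->
  #|[set x : E | x ^+ d == y ^+ d]| = d.
Proof.
move=> d_dv y0; rewrite -[RHS](card_unity_roots d_dv).
rewrite -[RHS](card_imset _ (mulfI y0)); apply: eq_card => x; rewrite inE.
apply/eqP/imsetP=> [xy|[t + ->]]; last by rewrite inE exprMn => /eqP->; rewrite mulr1.
exists (x / y); last by rewrite mulrC divfK.
by rewrite inE expr_div_n xy divff // expf_neq0.
Qed.

Lemma is_powerP d (y : E) : (d %| #|E|.-1)%N -> y != 0 ->
  y ^+ (#|E|.-1 %/ d) = 1 -> exists2 x, x != 0 & x ^+ d = y.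
Proof.
move=> d_dv y0 yn; have N_gt0 := card_pred_gt0.
have d_gt0 : (0 < d)%N by rewrite (dvdn_gt0 N_gt0).
have prim_ad : (#|E|.-1 %/ d).-primitive_root (a ^+ d).
  by have := exp_prim_root prim_a d; rewrite (gcdn_idPl d_dv).
have [i ->] := prim_rootP prim_ad yn.
exists (a ^+ i); last by rewrite exprAC.
by rewrite expf_neq0 // (prim_root_eq0 prim_a) -lt0n.
Qed.

(** As [x] runs over the nonzero elements, [x ^+ d] takes each value in the
    group of order [(#|E| - 1) / d] exactly [d] times, and the powers of [b]
    list this group once. *)
Lemma sum_powers d (b : E) (f : E -> nat) : (d %| #|E|.-1)%N ->
  (#|E|.-1 %/ d).-primitive_root b ->
  (\sum_(x | x != 0%R) f (x ^+ d)%R = d * \sum_(i < #|E|.-1 %/ d) f (b ^+ i)%R)%N.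
Proof.
set n := (_ %/ d)%N => d_dv prim_b.
have dn : (d * n)%N = #|E|.-1 by rewrite mulnC divnK.
have n_gt0 := prim_order_gt0 prim_b.
have b0 : b != 0 by rewrite (prim_root_eq0 prim_b) -lt0n.
have [h hP] : {h : E -> 'I_n | forall x, x != 0 -> x ^+ d = b ^+ h x}.
  have P x : {i : 'I_n | (x != 0) ==> (x ^+ d == b ^+ i)}.
    case: (eqVneq x 0) => [_|x0]; first by exists (Ordinal n_gt0).
    have xn : (x ^+ d) ^+ n = 1 by rewrite -exprM dn expf_card_pred.
    by have [i ->] := prim_rootP prim_b xn; exists i; rewrite eqxx.
  exists (fun x => sval (P x)) => x x0.
  by case: (P x) => i /=; rewrite x0 => /eqP.
rewrite (partition_big h xpredT) //= big_distrr /=; apply: eq_bigr => i _.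
have bi_n : (b ^+ i) ^+ n = 1 by rewrite exprAC (prim_expr_order prim_b) expr1n.
have [y y0 yd] := is_powerP d_dv (expf_neq0 i b0) bi_n.
rewrite (eq_bigr (fun=> f (b ^+ i))) => [|x /andP[x0 /eqP<-]]; last by rewrite hP.
rewrite sum_nat_cond_const; congr (_ * _)%N.
rewrite -[RHS](card_power_fibre d_dv y0); apply: eq_card => x; rewrite !inE.
rewrite yd; apply/andP/eqP=> [[x0 /eqP<-]|xd]; first exact: hP.
have x0 : x != 0.
  apply: contraTneq (expf_neq0 i b0) => x0; rewrite -xd x0 expr0n.
  by rewrite eqn0Ngt (dvdn_gt0 card_pred_gt0 d_dv) eqxx.
split=> //; move/eqP: (hP x x0); rewrite xd (eq_prim_root_expr prim_b).
by rewrite !modn_small // eq_sym => /eqP/val_inj/eqP.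
Qed.

End UnityRoots.

(** * The trace as a sum of conjugates *)

Section AbsoluteTrace.

(** The trace is pinned down by the sum of the conjugates alone, so that the
    big field can be any finite field that receives [F]. *)
Variables (F E : finFieldType) (iota : {rmorphism F -> E}) (m : nat).
Variable tr : E -> F.
Let q := #|F|.
Hypothesis card_ext : #|E| = (q ^ m)%N.
Hypothesis tr_sum : forall x, iota (tr x) = \sum_(0 <= j < m) x ^+ (q ^ j).

Lemma frobD k (x y : E) : (x + y) ^+ (q ^ k) = x ^+ (q ^ k) + y ^+ (q ^ k).
Proof.
apply: exprDn_pchar; have [p p_pr pF] := finPcharP F.
have pE : p \in [pchar E] by rewrite (fmorph_pchar iota).
rewrite (eq_pnat _ (pcharf_eq pE)) pnatX /q.
by rewrite (card_pprimeChar pF) pnatX pnat_id.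
Qed.

Lemma frob0 k : 0 ^+ (q ^ k) = 0 :> E.
Proof. by rewrite expr0n expn_eq0 eqn0Ngt (ltnW (finNzRing_gt1 F)). Qed.

Lemma frobN k (x : E) : (- x) ^+ (q ^ k) = - x ^+ (q ^ k).
Proof. by apply/eqP; rewrite -addr_eq0 -frobD addNr frob0. Qed.

Lemma frob_inj k : injective (fun x : E => x ^+ (q ^ k)).
Proof.
move=> x y /eqP; rewrite -subr_eq0 -frobN -frobD expf_eq0 => /andP[_].
by rewrite subr_eq0 => /eqP.
Qed.

Lemma frob_iota k c : iota c ^+ (q ^ k) = iota c.
Proof.
elim: k => [|k IH]; first by rewrite expn0 expr1.
by rewrite expnSr exprM IH -rmorphXn expf_card.
Qed.

Lemma trD : {morph tr : x y / x + y}.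
Proof.
move=> x y; apply: (fmorph_inj iota); rewrite rmorphD !tr_sum -big_split /=.
by apply: eq_bigr => j _; rewrite frobD.
Qed.

Lemma tr0 : tr 0 = 0.
Proof. by apply: (addrI (tr 0)); rewrite -trD !addr0. Qed.

Lemma trN : {morph tr : x / - x}.
Proof. by move=> x; apply/eqP; rewrite -addr_eq0 -trD addNr tr0. Qed.

Lemma trB : {morph tr : x y / x - y}.
Proof. by move=> x y; rewrite trD trN. Qed.

Lemma trZ c x : tr (iota c * x) = c * tr x.
Proof.
apply: (fmorph_inj iota); rewrite rmorphM !tr_sum mulr_sumr.
by apply: eq_bigr => j _; rewrite exprMn frob_iota.
Qed.

Lemma tr_frob k x : tr (x ^+ (q ^ k)) = tr x.
Proof.
elim: k => [|k <-]; first by rewrite expn0 expr1.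
apply: (fmorph_inj iota); rewrite !tr_sum; set y := x ^+ (q ^ k).
rewrite -/y expnSr exprM -/y; under eq_bigr do rewrite -exprM -expnS.
case: m card_ext => [|k'] cE; first by rewrite !big_nil.
rewrite [RHS]big_nat_recl // big_nat_recr //= -cE expf_card addrC.
by rewrite expn0 expr1.
Qed.

(** The trace is a polynomial of degree [q ^ (m - 1)], too small to vanish on
    all of [E]. *)
Lemma tr_neq0 : exists x, tr x != 0.
Proof.
have q_gt1 : (1 < q)%N := finNzRing_gt1 F.
apply/existsP; rewrite -[X in is_true X]negbK negb_exists.
apply/negP => /forallP tr_eq0.
pose P : {poly E} := \sum_(0 <= j < m) 'X^(q ^ j).
have m_gt0 : (0 < m)%N.
  by case: m card_ext => // /eqP; rewrite expn0 eqn_leq leqNgt finNzRing_gt1.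
have P0 : P != 0.
  apply/eqP => P0; have : P`_1 = 0 by rewrite P0 coef0.
  rewrite coef_sum big_ltn // coefXn expn0 eqxx big1_seq ?addr0 => [/eqP|j].
    by rewrite mulr1n oner_eq0.
  rewrite mem_index_iota => /andP[_ /andP[j_gt0 _]]; rewrite coefXn.
  by rewrite -[1%N](expn0 q) eqn_exp2l // eq_sym -[j == _]negbK -lt0n j_gt0.
have rootsP : all (root P) (enum E).
  apply/allP=> x _; rewrite rootE horner_sum.
  under eq_bigr do rewrite hornerXn.
  by rewrite -tr_sum fmorph_eq0; have := tr_eq0 x; rewrite negbK.
have := max_poly_roots P0 rootsP (enum_uniq _).
rewrite -cardT card_ext => ltP.
have : (size P <= (q ^ m.-1).+1)%N.
  apply: (leq_trans (size_sum _ _ _)); apply/bigmax_leqP_seq => j.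
  rewrite mem_index_iota => /andP[_ lt_jm] _; rewrite size_polyXn ltnS.
  by rewrite leq_exp2l // -ltnS prednK.
move/(leq_trans ltP); rewrite ltnS -[in X in (X <= _)%N](prednK m_gt0).
by rewrite leq_exp2l // ltnn.
Qed.

(** Nonzero functionals take every value equally often. *)
Lemma card_tr_fibre c k b : c != 0 ->
  (q * #|[set y | tr (c * y ^+ (q ^ k))%R == b]| = q ^ m)%N.
Proof.
move=> c0; have [z z0] := tr_neq0.
have frobK : bijective (fun x : E => x ^+ (q ^ k)) := injF_bij (@frob_inj k).
(* Translating by a multiple of [w] moves each fibre onto any other one. *)
have [w wz] : exists w, tr (c * w ^+ (q ^ k)) = 1.
  have [g fg gf] := frobK; exists (g (c^-1 * (iota (tr z)^-1 * z))).
  by rewrite gf mulVKf // trZ mulVf.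
pose A b := [set y | tr (c * y ^+ (q ^ k)) == b].
have cardA b' : #|A b'| = #|A 0|.
  have -> : A 0 = [set y - w * iota b' | y in A b'].
    apply/setP=> y; rewrite inE; apply/eqP/imsetP => [y0|[x + ->]].
      exists (y + w * iota b'); last by rewrite addrK.
      rewrite inE frobD mulrDr trD y0 exprMn frob_iota mulrA.
      by rewrite [_ * iota _]mulrC trZ wz mulr1 add0r.
    rewrite inE frobD frobN mulrBr trB exprMn frob_iota mulrA.
    by rewrite [_ * iota _]mulrC trZ wz mulr1 => /eqP->; rewrite subrr.
  by rewrite card_imset //; apply: addIr.
rewrite -card_ext -[RHS]sum1_card.
rewrite (partition_big (fun y => tr (c * y ^+ (q ^ k))) predT) //=.
rewrite (eq_bigr (fun=> #|A 0|)) => [|b' _]; last first.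
  by rewrite -(cardA b') -sum1_card; apply: eq_bigl => y; rewrite inE.
by rewrite sum_nat_const -(cardA b).
Qed.

(** Along the blocks of [e] consecutive conjugates the sign alternates, and
    there is an even number of blocks. *)
Lemma tr_antifixed e s w : m = (2 * e * s)%N -> w ^+ (q ^ e) = - w -> tr w = 0.
Proof.
move=> mE we; apply: (fmorph_inj iota); rewrite tr_sum mE rmorph0.
elim: s {mE} => [|s IH]; first by rewrite muln0 big_nil.
rewrite mulnS (big_cat_nat (n := 2 * e)) ?leq_addr //=.
rewrite -{2}[(2 * e)%N]add0n big_addn addKn.
have step j : w ^+ (q ^ (j + e)) = - w ^+ (q ^ j).
  by rewrite expnD mulnC exprM we frobN.
rewrite [X in X + _](_ : _ = 0) ?add0r; last first.
  rewrite (big_cat_nat (n := e)) //=; last by rewrite mul2n -addnn leq_addr.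
  rewrite -{2}[e]add0n big_addn mul2n -addnn addnK -big_split big1 //= => j _.
  by rewrite step subrr.
rewrite -[RHS]IH; apply: eq_bigr => j _.
by rewrite mul2n -addnn addnA !step opprK.
Qed.

End AbsoluteTrace.

(** * The quadratic forms Tr(g x^D) *)

Section NormFormSums.

Variables (F E : finFieldType) (iota : {rmorphism F -> E}) (m e s : nat).
Variable tr : E -> F.
Variable a : E.
Let q := #|F|.
Hypothesis mE : m = (2 * e * s)%N.
Hypothesis e_gt0 : (0 < e)%N.
Hypothesis card_ext : #|E| = (q ^ m)%N.
Hypothesis tr_sum : forall x, iota (tr x) = \sum_(0 <= j < m) x ^+ (q ^ j).
Hypothesis prim_a : #|E|.-1.-primitive_root a.

Let p := (q ^ e)%N.
Let D := (p + 1)%N.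
Let N := #|E|.

Definition fibre_card (g : E) (b : F) : nat := #|[set x | tr (g * x ^+ D) == b]|.

(** For every nontrivial additive character [psi] of [F] this is the sum of the
    [psi (tr (g * x ^+ D))], because the fibres over nonzero values all have the
    same size; as a difference of cardinals it is visibly an integer. *)
Definition exp_sum (g : E) : int :=
  (fibre_card g 0)%:Z - (fibre_card g 1)%:Z.

(** The polar form of [x |-> tr (g * x ^+ D)] at [u] and [y] is
    [tr (radical_form g u * y ^+ p)], see [tr_polar]. *)
Definition radical_form (g u : E) : E := g * u + g ^+ p * u ^+ (p ^ 2).

Local Notation A := fibre_card.
Local Notation S := exp_sum.

Let q_gt1 : (1 < q)%N. Proof. exact: finNzRing_gt1 F. Qed.

Let q1_gt0 : (0 < q.-1)%N. Proof. by rewrite -subn1 subn_gt0. Qed.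

Let qzE : q%:Z = q.-1%:Z + 1.
Proof. by rewrite -PoszD addn1 prednK // ltnW. Qed.

Let p_gt1 : (1 < p)%N.
Proof. by rewrite -(expn0 q) ltn_exp2l. Qed.

Let NE : N = ((p ^ 2) ^ s)%N.
Proof. by rewrite /N card_ext mE -!expnM mulnA mulnC [(2 * e)%N]mulnC mulnC. Qed.

Lemma dvd_sq_pred : ((p ^ 2).-1 %| N.-1)%N.
Proof. by rewrite NE dvdn_pred_predX. Qed.

Lemma dvd_den : (D %| N.-1)%N.
Proof.
apply: dvdn_trans dvd_sq_pred; rewrite /D -subn1 -[X in (_ - X)%N](exp1n 2).
by rewrite subn_sqr dvdn_mull.
Qed.

(** [q - 1] divides [p - 1], so nonzero scalars are [D]-th powers; scaling by
    a [D]-th root permutes the fibres over nonzero values. *)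
Lemma fibre_card_neq0 g b : b != 0 -> A g b = A g 1.
Proof.
move=> b0; have ib0 : iota b != 0 by rewrite fmorph_eq0.
have [z z0 zD] : exists2 z : E, z != 0 & z ^+ D = iota b.
  apply: (is_powerP prim_a dvd_den ib0); rewrite -/N.
  have /dvdnP[r ->] : (q.-1 %| N.-1 %/ D)%N.
    have D_gt0 : (0 < D)%N by rewrite /D addn1.
    rewrite -(dvdn_pmul2l D_gt0) [(D * (_ %/ _))%N]mulnC (divnK dvd_den).
    apply: dvdn_trans dvd_sq_pred; rewrite -[(p ^ 2).-1]subn1.
    rewrite -[X in (_ %| _ - X)%N](exp1n 2).
    by rewrite subn_sqr mulnC dvdn_mul // subn1 dvdn_pred_predX.
  by rewrite mulnC exprM -rmorphXn expf_card_pred // rmorph1 expr1n.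
rewrite /A -[RHS](card_imset _ (mulfI z0)); apply: eq_card => x; rewrite !inE.
have trz y : tr (g * (z * y) ^+ D) = b * tr (g * y ^+ D).
  by rewrite exprMn zD mulrCA (trZ tr_sum).
apply/eqP/imsetP=> [xb|[y + ->]]; last by rewrite inE trz => /eqP->; rewrite mulr1.
exists (x / z); last by rewrite mulrC divfK.
by rewrite inE; apply/eqP/(mulfI b0); rewrite -trz mulrCA divff // !mulr1.
Qed.

Lemma fibre_card_sum g (f : F -> nat) :
  (\sum_(x : E) f (tr (g * x ^+ D)%R)
    = A g 0%R * f 0%R + A g 1%R * \sum_(b | b != 0%R) f b)%N.
Proof.
rewrite (partition_big (fun x => tr (g * x ^+ D)) predT) //=.
have fib b :
  (\sum_(x | tr (g * x ^+ D)%R == b) f (tr (g * x ^+ D)%R) = A g b * f b)%N.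
  rewrite (eq_bigr (fun=> f b)) => [|x /eqP->//].
  by rewrite sum_nat_cond_const /A; congr (_ * _)%N; apply: eq_card => x; rewrite inE.
rewrite (eq_bigr _ (fun b _ => fib b)) (bigD1 0) //= big_distrr /=.
by congr (_ + _)%N; apply: eq_bigr => b /fibre_card_neq0->.
Qed.

Let sum_neq0 k : (\sum_(b : F | b != 0%R) k = q.-1 * k)%N.
Proof. by rewrite sum_nat_cond_const; rewrite cardsE -[q.-1](cardC1 (0 : F)). Qed.

Lemma fibre_card_total g : (A g 0%R + A g 1%R * q.-1 = N)%N.
Proof.
have := fibre_card_sum g (fun=> 1%N).
by rewrite sum1_card muln1 sum_neq0 muln1 => <-.
Qed.

Lemma fibre_card0E g : q%:Z * (A g 0)%:Z = N%:Z + q.-1%:Z * S g.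
Proof. by rewrite -(fibre_card_total g) PoszD PoszM /S qzE; ring. Qed.

Lemma fibre_card1E g : q%:Z * (A g 1)%:Z = N%:Z - S g.
Proof. by rewrite -(fibre_card_total g) PoszD PoszM /S qzE; ring. Qed.


Lemma exp_expand (x y : E) :
  (y + x) ^+ D = y ^+ D + (y ^+ p * x + x ^+ p * y) + x ^+ D.
Proof.
rewrite /D !addn1 !exprSr (frobD iota) mulrDl !mulrDr.
by rewrite !addrA.
Qed.

(** The trace is invariant under the Frobenius map [x |-> x ^+ p], which brings
    both terms to the common factor [y ^+ p]. *)
Lemma tr_polar g x y :
  tr (g * (y ^+ p * x + x ^+ p * y)) = tr (radical_form g x * y ^+ p).
Proof.
rewrite mulrDr (trD tr_sum).
rewrite -(tr_frob card_ext tr_sum e (g * (x ^+ p * y))) -(trD tr_sum).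
congr tr; rewrite /radical_form !exprMn mulrDl -exprM mulnn; ring.
Qed.

(** On the radical [w = g * x ^+ D] satisfies [w ^+ p = - w].  In odd
    characteristic the conclusion is the vanishing of twice the form; the
    argument through [w] covers characteristic 2 as well. *)
Lemma tr_radical g x : radical_form g x = 0 -> tr (g * x ^+ D) = 0.
Proof.
move=> gx; apply: (tr_antifixed tr_sum mE).
have gp : g ^+ p * x ^+ (p ^ 2) = - (g * x).
  by apply/eqP; rewrite -addr_eq0 addrC; apply/eqP.
rewrite exprMn -exprM /D mulnDl mul1n mulnn exprD mulrA gp.
by rewrite addn1 exprS mulNr mulrA.
Qed.

Definition radical (g : E) : {set E} := [set u | radical_form g u == 0].

(** Counting the pairs with [tr (g x^D) = tr (g y^D)] by the value taken, and
    by the difference [u = x - y]: for fixed [u] the condition on [y] is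
    affine, and its linear part vanishes exactly when [u] is in the radical,
    where [tr (g u^D) = 0] makes it hold for all [y]. *)
Lemma fibre_card_sq g :
  (q * (A g 0%R ^ 2 + A g 1%R ^ 2 * q.-1) = N * (#|radical g| * q.-1 + N))%N.
Proof.
have -> : (A g 0%R ^ 2 + A g 1%R ^ 2 * q.-1)%N
          = (\sum_(y : E) A g (tr (g * y ^+ D)%R))%N.
  rewrite fibre_card_sum (eq_bigr (fun=> A g 1)) ?sum_neq0.
    by rewrite -!mulnn [(q.-1 * _)%N]mulnC mulnA.
  exact: fibre_card_neq0.
have -> : (\sum_(y : E) A g (tr (g * y ^+ D)%R))%N =
  (\sum_u #|[set y | tr (radical_form g u * y ^+ p)%R == (- tr (g * u ^+ D))%R]|)%N.
  transitivity (\sum_(y : E) \sum_(u : E)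
     (tr (radical_form g u * y ^+ p)%R == (- tr (g * u ^+ D))%R))%N.
    apply: eq_bigr => y _; rewrite /A -sum1dep_card big_mkcond /=.
    rewrite (reindex_inj (addrI y)) /=; apply: eq_bigr => u _.
    rewrite exp_expand !mulrDr !(trD tr_sum) -(trD tr_sum) -mulrDr.
    rewrite tr_polar -addrA -subr_eq0 addrAC subrr add0r addr_eq0.
    by case: ifP.
  rewrite exchange_big; apply: eq_bigr => u _.
  by rewrite -sum1dep_card [RHS]big_mkcond /=; apply: eq_bigr => y _; case: ifP.
rewrite big_distrr /= (bigID (mem (radical g))) /=.
rewrite (eq_bigr (fun=> (q * N)%N)) => [|u]; last first.
  rewrite inE => /eqP gu; congr (_ * _)%N; apply: eq_card => y.
  by rewrite inE gu mul0r (tr0 tr_sum) (tr_radical gu) oppr0 eqxx.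
rewrite sum_nat_const [X in (_ + X)%N](eq_bigr (fun=> N)) => [|u]; last first.
  rewrite inE => gu; rewrite (card_tr_fibre card_ext tr_sum e _ gu).
  by rewrite /N card_ext.
rewrite sum_nat_cond_const.
have -> : #|[set u | u \notin radical g]| = (N - #|radical g|)%N.
  rewrite -[N](cardsC (radical g)) addKn.
  by apply: eq_card => u; rewrite !inE.
have le_rN : (#|radical g| <= N)%N := max_card _.
rewrite mulnA -mulnDl mulnC; congr (_ * _)%N.
by rewrite -{1}(prednK (ltnW q_gt1)) mulnS addnAC subnKC // addnC.
Qed.

(** Both fibre sizes are affine in [S g], and the counting identity for pairs
    becomes this one after the factor [q * (q - 1)] is cancelled. *)
Lemma exp_sum_sq g : S g ^+ 2 = #|radical g|%:Z * N%:Z.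
Proof.
have := fibre_card0E g; have := fibre_card1E g; have := fibre_card_sq g.
set A0 := A g 0; set A1 := A g 1; set R := #|_|; set x := S g => h h1 h0.
have q0 : 0 < q%:Z * q.-1%:Z by rewrite mulr_gt0 // ltz_nat ltnW.
have h2 : q%:Z * (A0%:Z ^+ 2 + A1%:Z ^+ 2 * q.-1%:Z)
          = N%:Z * (R%:Z * q.-1%:Z + N%:Z).
  by have := congr1 Posz h; rewrite !PoszM !PoszD !PoszM.
apply: (mulfI (lt0r_neq0 q0)).
have : q%:Z * (q%:Z * (A0%:Z ^+ 2 + A1%:Z ^+ 2 * q.-1%:Z)) =
   (q%:Z * A0%:Z) ^+ 2 + (q%:Z * A1%:Z) ^+ 2 * q.-1%:Z by ring.
rewrite h2 h0 h1 qzE => h3.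
have -> : (q.-1%:Z + 1) * q.-1%:Z * x ^+ 2 =
  (N%:Z + q.-1%:Z * x) ^+ 2 + (N%:Z - x) ^+ 2 * q.-1%:Z
  - (q.-1%:Z + 1) * N%:Z ^+ 2 by ring.
by rewrite -h3; ring.
Qed.

(** If [u] is a nonzero element of the radical, then [u * t] is in it exactly
    when [t ^+ (p ^ 2) = t]. *)
Lemma card_radical g : g != 0 -> #|radical g| = 1%N \/ #|radical g| = (p ^ 2)%N.
Proof.
move=> g0; have rad0 : 0 \in radical g.
  by rewrite inE /radical_form mulr0 expr0n expn_eq0 eqn0Ngt ltnW //= mulr0 addr0.
case: (pickP [pred u | (u != 0) && (u \in radical g)]) => [u /andP[u0 ur] | none].
  right; have mul_u t : radical_form g (u * t) = g * u * (t - t ^+ (p ^ 2)).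
    move: ur; rewrite inE /radical_form addrC addr_eq0 => /eqP.
    by rewrite !exprMn !mulrA => ->; rewrite mulrBr mulNr.
  have radE t : (u * t \in radical g) = (t == 0) || (t ^+ (p ^ 2).-1 == 1).
    rewrite inE mul_u !mulf_eq0 (negPf g0) (negPf u0) /=.
    have -> : t - t ^+ (p ^ 2) = t * (1 - t ^+ (p ^ 2).-1).
      by rewrite mulrBr mulr1 -exprS prednK // expn_gt0 ltnW.
    by rewrite mulf_eq0 subr_eq0 [1 == _]eq_sym.
  have -> : radical g = [set u * t | t in 0 |: [set t | t ^+ (p ^ 2).-1 == 1]].
    apply/setP=> x; apply/idP/imsetP => [xr|[t + ->]]; last by rewrite radE !inE.
    by exists (x / u); rewrite ?[u * _]mulrC ?divfK // !inE -radE mulrC divfK.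
  rewrite (card_imset _ (mulfI u0)) cardsU1 (card_unity_roots prim_a dvd_sq_pred).
  have p2 : (1 < p ^ 2)%N by rewrite -(exp1n 2) ltn_exp2r.
  by rewrite inE expr0n (_ : _ == 0 = false)%N ?eqxx 1?eq_sym ?oner_eq0 /=; lia.
left; apply/eqP/cards1P; exists 0; apply/setP=> x; rewrite [in RHS]inE.
have [->|x0] := eqVneq x 0; first exact: rad0.
by have := none x; rewrite /= x0.
Qed.


Let N_gt1 : (1 < N)%N. Proof. exact: finNzRing_gt1 E. Qed.

Let D_gt0 : (0 < D)%N. Proof. by rewrite /D addn1. Qed.

Let NzE : N%:Z = N.-1%:Z + 1.
Proof. by rewrite -PoszD addn1 prednK // ltnW. Qed.

Let n := (N.-1 %/ D)%N.

Let nD : (D * n)%N = N.-1.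
Proof. by rewrite mulnC divnK // dvd_den. Qed.

Lemma sum_fibre_codomain (b : E) (f : E -> nat) : n.-primitive_root b ->
  (\sum_(x : E) f (x ^+ D)%R = f 0%R + D * \sum_(i < n) f (b ^+ i)%R)%N.
Proof.
move=> prim_b; rewrite (bigD1 0) //= (sum_powers prim_a f dvd_den prim_b).
by rewrite expr0n eqn0Ngt D_gt0.
Qed.

Lemma fibre_cardE (b : E) g c : n.-primitive_root b ->
  A g c = ((c == 0)%R + D * #|[set i : 'I_n | tr (g * b ^+ i)%R == c]|)%N.
Proof.
move=> prim_b; have -> : A g c = (\sum_(x : E) (tr (g * x ^+ D)%R == c))%N.
  by rewrite /A -sum1dep_card big_mkcond; apply: eq_bigr => x _; case: ifP.
rewrite (sum_fibre_codomain (fun x => tr (g * x) == c) prim_b).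
rewrite mulr0 (tr0 tr_sum) eq_sym; congr (_ + D * _)%N.
by rewrite -sum1dep_card [RHS]big_mkcond; apply: eq_bigr => i _; case: ifP.
Qed.

(** The fibre over [1] avoids [0] and is a union of fibres of the [D]-th power
    map, so [D] divides its size; and [D] divides [N - 1]. *)
Lemma exp_sum_mod g : (D%:Z %| S g - 1)%Z.
Proof.
have prim_b : n.-primitive_root (a ^+ D).
  by have := exp_prim_root prim_a D; rewrite (gcdn_idPl dvd_den).
have : S g - 1 = D%:Z * (n%:Z - q%:Z *
    #|[set i : 'I_n | tr (g * (a ^+ D) ^+ i)%R == 1]|%:Z).
  have := fibre_card1E g; rewrite (fibre_cardE g 1 prim_b) oner_eq0 add0n.
  rewrite PoszM => h; have -> : S g - 1 = N.-1%:Z - (N%:Z - S g).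
    by rewrite NzE; ring.
  by rewrite -h -nD PoszM; ring.
by move=> ->; apply: dvdz_mulr.
Qed.

Let PoszX (k j : nat) : (k ^ j)%:Z = k%:Z ^+ j.
Proof. by rewrite -!natz natrX. Qed.

Let z : int := - p%:Z.

Let NEz : N%:Z = (z ^+ s) ^+ 2.
Proof. by rewrite NE -exprM mulnC exprM /z sqrrN PoszX. Qed.

(** Since [z = 1] modulo [D], the other square root would give [1 = - 1] modulo
    [D], which is at least 3. *)
Lemma exp_sum_sign g k : S g ^+ 2 = (z ^+ k) ^+ 2 -> S g = z ^+ k.
Proof.
move=> /eqP; rewrite eqf_sqr => /orP[/eqP//|/eqP Sg].
have zk : (D%:Z %| z ^+ k - 1)%Z.
  by rewrite subrX1 dvdz_mulr // /z /D PoszD -opprD rpredN.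
have := rpredD (exp_sum_mod g) zk; rewrite Sg.
rewrite (_ : _ + _ = - 2%:Z); last by ring.
by rewrite rpredN => /dvdn_leq; rewrite /D /=; lia.
Qed.

Lemma exp_sum_neq0 g : g != 0 -> S g = z ^+ s \/ S g = z ^+ s.+1.
Proof.
move=> /card_radical[] rad_g; have := exp_sum_sq g; rewrite rad_g NEz.
  by rewrite mul1r => /exp_sum_sign; left.
move=> Sg; right; apply: exp_sum_sign; rewrite Sg [z ^+ s.+1]exprS exprMn.
by rewrite /z sqrrN PoszX.
Qed.

Lemma fibre_card_g0 b : A 0 b = if b == 0 then N else 0%N.
Proof.
rewrite /A; case: eqP => [->|b0].
  by rewrite -[N]cardsT; apply: eq_card => x; rewrite !inE mul0r (tr0 tr_sum) eqxx.
by apply: eq_card0 => x; rewrite !inE mul0r (tr0 tr_sum) eq_sym; apply/eqP.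
Qed.

(** The pairs [(g, x)] with [tr (g * x ^+ D) = 0] are counted for fixed [g] by the
    fibre sizes, and for fixed [x <> 0] by the kernel of a nonzero functional.
    The term [g = 0] alone already accounts for the total [N]. *)
Lemma sum_exp_sum : \sum_(g : E | g != 0) S g = 0.
Proof.
have sumA : (q * \sum_(g : E) A g 0%R = q * N + N.-1 * N)%N.
  have -> : (\sum_(g : E) A g 0%R =
      \sum_(x : E) #|[set g | tr (x ^+ D * g ^+ (q ^ 0))%R == 0%R]|)%N.
    transitivity (\sum_(g : E) \sum_(x : E) (tr (g * x ^+ D)%R == 0%R))%N.
      apply: eq_bigr => g _; rewrite /A -sum1dep_card [LHS]big_mkcond.
      by apply: eq_bigr => x _; case: ifP.
    rewrite exchange_big; apply: eq_bigr => x _.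
    rewrite -sum1dep_card [RHS]big_mkcond; apply: eq_bigr => g _.
    by rewrite expn0 expr1 mulrC; case: ifP.
  rewrite big_distrr (bigD1 0) //=; congr (_ + _)%N.
    congr (_ * _)%N; rewrite -[RHS]cardsT; apply: eq_card => g.
    by rewrite !inE expr0n eqn0Ngt D_gt0 mul0r (tr0 tr_sum) eqxx.
  rewrite (eq_bigr (fun=> N)) => [|x x0]; last first.
    by rewrite (card_tr_fibre card_ext tr_sum) ?expf_neq0.
  by rewrite sum_nat_cond_const cardsE (cardC1 (0 : E)).
have q10 : q.-1%:Z != 0 by rewrite eqz_nat -lt0n.
have S0 : S 0 = N%:Z by rewrite /S !fibre_card_g0 eqxx oner_eq0 subr0.
apply: (mulfI q10); rewrite mulr0 mulr_sumr.
have : \sum_g (q.-1%:Z * S g) = q.-1%:Z * N%:Z.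
  have -> : \sum_g (q.-1%:Z * S g) = \sum_g (q%:Z * (A g 0)%:Z - N%:Z).
    by apply: eq_bigr => g _; rewrite fibre_card0E addrC addKr.
  rewrite big_split sumr_const /= -mulr_sumr -(big_morph Posz PoszD (erefl _)).
  rewrite -PoszM sumA -/N PoszD !PoszM mulNrn -mulr_natr natz.
  by rewrite NzE qzE; ring.
by rewrite (bigD1 0) //= S0 -[RHS]addr0 => /addrI.
Qed.

(** By parity of the exponents the two values are opposite in sign, their
    absolute values are in ratio [p], and the sum of all [S g] vanishes; this
    pins the two frequencies. *)
Lemma sum_over_exp_sum (h : int -> nat) :
  (\sum_(g : E | g != 0%R) h (S g) = n * p * h (z ^+ s) + n * h (z ^+ s.+1))%N.
Proof.
have mulrn_nat (x k : nat) : x *+ k = (x * k)%N by rewrite -mulr_natr natn.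
pose P1 := [set g : E | (g != 0) && (S g == z ^+ s)].
pose P2 := [set g : E | (g != 0) && (S g != z ^+ s)].
have SP2 g : g != 0 -> S g != z ^+ s -> S g = z ^+ s.+1.
  by move=> /exp_sum_neq0[->|//]; rewrite eqxx.
have split (R : nmodType) (f : int -> R) :
    \sum_(g : E | g != 0) f (S g) = f (z ^+ s) *+ #|P1| + f (z ^+ s.+1) *+ #|P2|.
  rewrite (bigID (fun g => S g == z ^+ s)) /=; congr (_ + _).
    rewrite (eq_bigr (fun=> f (z ^+ s))) => [|g /andP[_ /eqP->]//].
    by rewrite sumr_const; congr (_ *+ _); apply: eq_card => g; rewrite inE.
  rewrite (eq_bigr (fun=> f (z ^+ s.+1))) => [|g /andP[g0 /(SP2 g g0)->]//].
  by rewrite sumr_const; congr (_ *+ _); apply: eq_card => g; rewrite inE.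
have z0 : z ^+ s != 0.
  by rewrite expf_eq0 oppr_eq0 negb_and eqz_nat -lt0n (ltnW p_gt1) orbT.
have c1 : #|P1| = (p * #|P2|)%N.
  have h0 := split int id; rewrite sum_exp_sum exprS in h0.
  apply/eqP; rewrite -eqz_nat -subr_eq0; apply/eqP/(mulfI z0).
  rewrite mulr0 [RHS]h0 -[_ *+ #|P1|]mulr_natr -[_ *+ #|P2|]mulr_natr !natz PoszM.
  by rewrite mulrDr /z [- p%:Z * _]mulrC -mulrA mulNr.
have c2 : (#|P1| + #|P2| = D * n)%N.
  have := split nat (fun=> 1%N).
  rewrite sum_nat_cond_const cardsE (cardC1 (0 : E)) muln1 -/N -nD => ->.
  by rewrite !mulrn_nat !mul1n.
have cn : #|P2| = n.
  by apply/eqP; rewrite -(eqn_pmul2l D_gt0) -c2 c1 /D mulnDl mul1n.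
by rewrite split c1 cn !mulrn_nat [(p * n)%N]mulnC !(mulnC (h _)).
Qed.

End NormFormSums.

(** * The gcd of q^l + 1 and q^m - 1 *)

Section GcdPowers.

(** The exponents [k] with [x ^ k = 1] modulo [d] are closed under gcd, by
    Bezout. *)
Lemma dvdz_expr_gcdn (d x : int) i j : (0 < i)%N ->
  (d %| x ^+ i - 1)%Z -> (d %| x ^+ j - 1)%Z -> (d %| x ^+ gcdn i j - 1)%Z.
Proof.
move=> i_gt0 di dj; have [u v uv _] := egcdnP j i_gt0.
have dX k t : (d %| x ^+ k - 1)%Z -> (d %| x ^+ (t * k) - 1)%Z.
  by rewrite mulnC exprM => dk; rewrite subrX1 dvdz_mulr.
have -> : x ^+ gcdn i j - 1
  = (x ^+ (u * i) - 1) - (x ^+ (v * j) - 1) * x ^+ gcdn i j.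
  by rewrite uv exprD; ring.
by rewrite rpredB ?dvdz_mulr // dX.
Qed.

(** With [z = - q ^ e] both numbers are, up to sign, of the form [z ^ k - 1]:
    the exponents are [l / e], which is odd, and [m / e], which is even. *)
Lemma gcdn_expn_succ_pred q m l : (0 < q)%N -> (0 < m)%N ->
  ~~ odd (m %/ gcdn m l) ->
  gcdn (q ^ l + 1) (q ^ m - 1) = (q ^ gcdn m l + 1)%N.
Proof.
move=> q_gt0 m_gt0; set e := gcdn m l => ev.
have e_gt0 : (0 < e)%N by rewrite gcdn_gt0 m_gt0.
have lE : (l %/ e * e)%N = l by rewrite divnK // dvdn_gcdr.
have mE : (m %/ e * e)%N = m by rewrite divnK // dvdn_gcdl.
have co : gcdn (l %/ e) (m %/ e) = 1%N.
  by apply/eqP; rewrite -(eqn_pmul2r e_gt0) muln_gcdl lE mE mul1n gcdnC.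
have odl : odd (l %/ e).
  apply: contraT => evl; have : (2 %| gcdn (l %/ e) (m %/ e))%N.
    by rewrite dvdn_gcd !dvdn2 evl ev.
  by rewrite co.
pose z : int := - (q ^ e)%N%:Z.
have zl : (q ^ l + 1)%N%:Z = - (z ^+ (l %/ e) - 1).
  rewrite /z exprNn -signr_odd odl expr1 mulN1r PoszD -!natz -natrX -expnM mulnC lE.
  by ring.
have zm : (q ^ m - 1)%N%:Z = z ^+ (m %/ e) - 1.
  rewrite /z exprNn -signr_odd (negPf ev) expr0 mul1r -!natz -natrX -expnM mulnC mE.
  by rewrite natrB ?expn_gt0 ?q_gt0.
have ze : (q ^ e + 1)%N%:Z = - (z - 1) by rewrite PoszD opprB opprK addrC.
have dvdzP (x y : nat) : (x %| y)%N = (x%:Z %| y%:Z)%Z by [].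
apply/eqP; rewrite eqn_dvd dvdn_gcd !dvdzP zl zm ze.
have dN d x : (d %| - x)%Z = (d %| x)%Z by rewrite rpredN.
have Nd d x : (- d %| x)%Z = (d %| x)%Z by rewrite !dvdzE abszN.
rewrite !dN !Nd; apply/and3P; split.
- have -> : z - 1 = z ^+ gcdn (l %/ e) (m %/ e) - 1 by rewrite co.
  apply: dvdz_expr_gcdn.
  + by case: (l %/ e)%N odl.
  + by rewrite -dN -zl -dvdzP dvdn_gcdl.
  + by rewrite -zm -dvdzP dvdn_gcdr.
- by rewrite subrX1 dvdz_mulr.
- by rewrite subrX1 dvdz_mulr.
Qed.

End GcdPowers.

(** The Galois group over a finite field is cyclic, generated by the
    [#|F|]-power map. *)
Lemma Tr_conjugates (F : finFieldType) (L : splittingFieldType F) (x : L) :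
  (Tr x)%:A = \sum_(0 <= j < \dim {:L}) x ^+ (#|F| ^ j).
Proof.
rewrite TrE /galTrace.
have [phi /eqP gen_phi phiE] := finField_galois_generator (sub1v {:L}).
have ord_phi : #[phi]%g = \dim {:L}.
  rewrite orderE -gen_phi -galois_dim ?dimv1 ?divn1 //.
  exact: finField_galois (sub1v _).
have phiX j y : (phi ^+ j)%g y = y ^+ (#|F| ^ j).
  elim: j => [|j IH]; first by rewrite gal_id expn0 expr1.
  by rewrite expgSr galM ?memvf // IH phiE ?memvf //= dimv1 expn1 expnSr exprM.
rewrite gen_phi -ord_phi big_mkord.
rewrite (reindex_onto (fun i : 'I_#[phi]%g => (phi ^+ i)%g)
  (fun f => odflt (Ordinal (order_gt0 phi))
     [pick i : 'I_#[phi]%g | (phi ^+ i)%g == f])).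
  apply: eq_big => [i|i _]; last exact: phiX.
  rewrite mem_cycle /=; case: pickP => [k|/(_ i)]; last by rewrite eqxx.
  by rewrite eq_expg_mod_order !modn_small // => /eqP/val_inj->; rewrite eqxx.
move=> f /cyclePmin[i lt_i ->]; case: pickP => [k /eqP//|/(_ (Ordinal lt_i))].
by rewrite eqxx.
Qed.

(** * Linear codes and their weights *)

Section LinearCodeWeights.

Variables (F : finFieldType) (n : nat).
Implicit Types (u v : 'rV[F]_n) (V : {vspace 'rV[F]_n}).

Lemma hamming_distE u v : hamming_dist u v = hamming_weight (u - v).
Proof. by apply: eq_card => i; rewrite !inE !mxE subr_eq0. Qed.

Lemma hamming_weight0 : hamming_weight (0 : 'rV[F]_n) = 0%N.
Proof. by apply: eq_card0 => i; rewrite !inE mxE eqxx. Qed.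

Lemma is_codeI (C : {set 'rV[F]_n}) k d :
    (exists2 V : {vspace 'rV[F]_n}, C = [set u in V] & \dim V = k) ->
    (exists2 u, u \in C & u != 0 /\ hamming_weight u = d) ->
    (forall u, u \in C -> u != 0 -> (d <= hamming_weight u)%N) ->
  is_code C k d.
Proof.
move=> [V CV dimV] [u Cu [u0 ud]] minC; split; first by exists V.
have C0 : 0 \in C by rewrite CV inE mem0v.
split=> [|v w Cv Cw]; first by exists u, 0; rewrite hamming_distE subr0.
rewrite hamming_distE -subr_eq0; apply: minC.
by move: Cv Cw; rewrite CV !inE; apply: rpredB.
Qed.

Lemma card_imset_weight (T : finType) (f : T -> 'rV[F]_n) (w : rat) :
  injective f ->
  #|[set u in [set f x | x : T] | (hamming_weight u)%:R == w]|
    = (\sum_(x : T) ((hamming_weight (f x))%:R == w :> rat))%N.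
Proof.
move=> f_inj; transitivity #|[set x | (hamming_weight (f x))%:R == w :> rat]|.
  rewrite -[RHS](card_imset _ f_inj); apply: eq_card => u; rewrite inE.
  apply/andP/imsetP=> [[/imsetP[x _ ->] wx]|[x + ->]].
    by exists x; rewrite ?inE.
  by rewrite inE => wx; rewrite imset_f.
by rewrite -sum1dep_card big_mkcond; apply: eq_bigr => x _; case: ifP.
Qed.

End LinearCodeWeights.

Section CodeSpaces.

Variables (F : finFieldType) (L : splittingFieldType F) (n l : nat) (a : L).
Local Notation cw := (codeword n l a).

Lemma Tr_linear (k : F) (x y : L) : Tr (k *: x + y) = k * Tr x + Tr y.
Proof.
rewrite /Tr /galTrace -[k * _]linearZ -linearD /= scaler_sumr -big_split /=.
by congr (coord _ _ _); apply: eq_bigr => f _; rewrite linearP.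
Qed.

Lemma codeword_linear k g h c d :
  cw (k *: g + h) (k * c + d) = k *: cw g c + cw h d.
Proof.
apply/rowP=> i; rewrite !mxE mulrDl -scalerAl Tr_linear; ring.
Qed.

Lemma codeword_split g c : cw g c = cw g 0 + c *: cw 0 1.
Proof.
rewrite -[cw g c](_ : cw (c *: 0 + g) (c * 1 + 0) = _).
  by rewrite codeword_linear addrC.
by rewrite scaler0 add0r mulr1 addr0.
Qed.

Hypothesis codeword_eq0 : forall g c, cw g c = 0 -> g = 0 /\ c = 0.

Lemma codeword_inj g h c d : cw g c = cw h d -> g = h /\ c = d.
Proof.
move/eqP; rewrite eq_sym -subr_eq0 -scaleN1r addrC -codeword_linear => /eqP.
case/codeword_eq0; rewrite scaleN1r mulN1r ![- _ + _]addrC => /eqP + /eqP.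
by rewrite !subr_eq0 => /eqP-> /eqP->.
Qed.

Let cw0 (g : L) := cw g 0.

Let cw0_linear : linear cw0.
Proof.
move=> k g h; rewrite /cw0 -codeword_linear.
by rewrite mulr0 addr0.
Qed.

Let cw0L : {linear L -> 'rV[F]_n} :=
  HB.pack cw0 (GRing.isLinear.Build F L 'rV[F]_n *:%R cw0 cw0_linear).

Let V0 := limg (linfun cw0L).

Let mem_V0 u : reflect (exists g, u = cw g 0) (u \in V0).
Proof.
apply: (iffP memv_imgP) => [[g _ ->]|[g ->]]; first by exists g; rewrite lfunE.
by exists g; rewrite ?memvf ?lfunE.
Qed.

Let dimV0 : \dim V0 = \dim {:L}.
Proof.
apply: limg_dim_eq; apply/eqP; rewrite -subv0; apply/subvP=> g.
rewrite memv_cap memv_ker lfunE /= => /andP[_ /eqP/codeword_eq0[-> _]].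
exact: mem0v.
Qed.

Lemma code_C_vspace :
  exists2 V : {vspace 'rV[F]_n}, code_C n l a = [set u in V] & \dim V = \dim {:L}.
Proof.
exists V0 => //; apply/setP=> u; rewrite [in RHS]inE.
apply/imsetP/mem_V0 => [[g _ ->]|[g ->]]; first by exists g.
by exists g.
Qed.

Lemma code_C0_vspace :
  exists2 V : {vspace 'rV[F]_n},
    code_C0 n l a = [set u in V] & \dim V = (\dim {:L} + 1)%N.
Proof.
exists (V0 + <[cw 0%R 1%R]>)%VS.
  apply/setP=> u; rewrite [in RHS]inE; apply/imset2P/memv_addP.
    case=> g c _ _ ->; exists (cw g 0); first by apply/mem_V0; exists g.
    by exists (c *: cw 0 1); rewrite ?memvZ ?memv_line // codeword_split.
  case=> _ /mem_V0[g ->] [_ /vlineP[c ->] ->].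
  by exists g c; rewrite -?codeword_split.
rewrite dimv_disjoint_sum ?dimV0 ?dim_vline.
  by case: eqP => // /codeword_eq0[_ /eqP]; rewrite oner_eq0.
apply/eqP; rewrite -subv0; apply/subvP=> u; rewrite memv_cap.
case/andP=> /mem_V0[g ug] /vlineP[c uc].
have cw00 : cw 0 0 = 0.
  by rewrite -[RHS](subrr (cw 0 0)) -scaleN1r addrC -codeword_linear
     scaler0 addr0 mulr0 addr0.
have : cw g 0 = cw 0 c by rewrite (codeword_split 0 c) cw00 add0r -uc ug.
by case/codeword_inj=> g0 _; rewrite ug g0 cw00 mem0v.
Qed.

End CodeSpaces.

Lemma sum_freq_cons (p : rat * nat) s w :
  (\sum_(r <- p :: s | r.1 == w) r.2
    = p.2 * (p.1 == w) + \sum_(r <- s | r.1 == w) r.2)%N.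
Proof. by rewrite big_cons; case: (p.1 == w); rewrite ?muln1 ?muln0. Qed.

(** Enough products of the inequalities to make every later comparison of
    weights linear; [Y] stands for [q ^ (m / 2)], and [s >= 2] gives the last
    hypothesis. *)
Lemma weight_bounds (Q P Y : rat) : 2 <= Q -> Q <= P -> P * P <= Y ->
  [/\ 4 <= Y, Q <= Y, 2 * Y <= Q * Y, Q * Y <= Y * P
  & [/\ 2 * (Y * P) <= Y * Y, Y * P <= (Q - 1) * (Y * P),
        Y * Y <= (Q - 1) * (Y * Y)
      & Y * Y - Y * P <= (Q - 1) * (Y * Y - Y * P)]].
Proof.
move=> Q2 QP PY.
have PP : 2 * P <= P * P by rewrite ler_pM2r; lra.
have Q1 : 1 <= Q - 1 by lra.
have YP0 : 0 <= Y * P by rewrite mulr_ge0; lra.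
have YY : 2 * (Y * P) <= Y * Y by rewrite mulrCA ler_pM2l; lra.
have pmul z : 0 <= z -> z <= (Q - 1) * z.
  by move=> z0; rewrite -[leLHS]mul1r ler_wpM2r.
split; [lra|lra|by rewrite ler_pM2r; lra|by rewrite mulrC ler_pM2l; lra|].
by split; [by []|apply: pmul; lra..].
Qed.

(** * Weights of the trace codes *)

Section Weights.

Variables (F : finFieldType) (L : splittingFieldType F) (l : nat).
Variable alpha : {unit (finvect_type L)}.
(* [T] and [L] have the same elements and operations; counting takes place in
   [T], linear algebra and the trace in [L]. *)
Let T : finFieldType := finvect_type L.
Let q := #|F|.
Let m := \dim {:L}.
Hypothesis gen_alpha : generator [set: {unit (finvect_type L)}] alpha.
Hypothesis m_gt0 : (0 < m)%N.
Hypothesis l_gt0 : (0 < l)%N.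
Hypothesis lt_lm : (2 * l < m)%N.
Hypothesis even_me : ~~ odd (m %/ gcdn m l).

Let e := gcdn m l.
Let s := (m %/ e)./2.
Let D := code_den q m l.
Let n := code_len q m l.
Let a : T := FinRing.uval alpha.
Let iota : {rmorphism F -> T} := in_alg T.
Let tr : T -> F := @Tr F L.

Let e_gt0 : (0 < e)%N. Proof. by rewrite gcdn_gt0 m_gt0. Qed.

Let mE : m = (2 * e * s)%N.
Proof.
rewrite [(2 * e)%N]mulnC -mulnA mul2n even_halfK // mulnC divnK //.
exact: dvdn_gcdl.
Qed.

(* For [s = 1] the number [l] would be a multiple of [e = m / 2]. *)
Let s_gt1 : (1 < s)%N.
Proof.
have le_el : (e <= l)%N by rewrite dvdn_leq // dvdn_gcdr.
move: mE lt_lm; case: (s) => [|[|//]]; first by rewrite muln0 => ->.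
by rewrite muln1 => ->; rewrite ltn_pmul2l // ltnNge le_el.
Qed.

Let card_ext : #|T| = (q ^ m)%N.
Proof.
pose vT := Vector.class (finvect_type L).
exact: etrans (esym (@card_vspacef F T vT)) (@card_vspace F T vT fullv).
Qed.

Let tr_sum (x : T) : iota (tr x) = \sum_(0 <= j < m) x ^+ (q ^ j).
Proof. exact (@Tr_conjugates F L x). Qed.

Let prim_a : #|T|.-1.-primitive_root a.
Proof. exact: generator_primitive_root. Qed.


Let q_gt1 : (1 < q)%N. Proof. exact: finNzRing_gt1 F. Qed.

Let predNE : #|T|.-1 = (q ^ m - 1)%N.
Proof. by rewrite card_ext subn1. Qed.

Let D_dvd : (D %| q ^ m - 1)%N.
Proof. exact: code_den_dvd. Qed.

Let nD : (D * n)%N = (q ^ m - 1)%N.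
Proof. by rewrite mulnC divnK. Qed.

Let D_gt0 : (0 < D)%N. Proof. by rewrite /D /code_den addn1. Qed.

Let n_gt0 : (0 < n)%N.
Proof.
rewrite -(ltn_pmul2l D_gt0) muln0 nD subn_gt0 -(expn0 q).
by rewrite ltn_exp2l.
Qed.

Let b := a ^+ (q ^ l + 1).

Let prim_b : n.-primitive_root b.
Proof.
have := exp_prim_root prim_a (q ^ l + 1); rewrite predNE.
by rewrite gcdn_expn_succ_pred // ltnW.
Qed.

Local Notation A := (fibre_card e tr).
Local Notation S := (exp_sum e tr).
Local Notation cw := (codeword n l (a : L)).

Lemma codewordE (g : T) c i : cw g c 0 i = tr (g * b ^+ i) + c.
Proof. by rewrite mxE exprM. Qed.

(** The zeros of the codeword are the [i] at which the trace equals [- c]; the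
    fibre over [- c] contains [D] elements for each of them, and also [0] if
    [c = 0]. *)
Lemma weight_fibre_card (g : T) c :
  (D * hamming_weight (cw g c) + A g (- c)%R = D * n + (c == 0%R))%N.
Proof.
have prim_b' : (#|T|.-1 %/ (q ^ e + 1)).-primitive_root b by rewrite predNE.
have := fibre_cardE mE card_ext tr_sum prim_a g (- c) prim_b'.
rewrite predNE -[((q ^ m - 1) %/ _)%N]/n oppr_eq0 => ->.
rewrite addnCA addnC -mulnDr; congr (_ * _ + _)%N.
rewrite -[RHS](card_ord n) -(cardsC [set i | cw g c 0 i != 0]).
congr (_ + _)%N; apply: eq_card => i.
by rewrite !inE negbK codewordE addr_eq0.
Qed.

Let Q : rat := q%:R.

Let sigma (g : T) : rat := (S g)%:~R.

(* [q * D] times the weight of a codeword with exponential sum [x]. *)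
Let scaled_weight (x : rat) (c : F) : rat :=
  if c == 0 then (Q - 1) * (Q ^+ m - x) else (Q - 1) * Q ^+ m + x - Q.

Lemma weightE (g : T) c :
  Q * D%:R * (hamming_weight (cw g c))%:R = scaled_weight (sigma g) c.
Proof.
have Ncast : (#|T|%:Z)%:~R = Q ^+ m :> rat by rewrite -pmulrn card_ext natrX.
have q1cast : (q.-1%:Z)%:~R = Q - 1 :> rat.
  by rewrite -pmulrn -subn1 natrB // ltnW.
have Dn : D%:R * n%:R = Q ^+ m - 1 :> rat.
  by rewrite -natrM nD natrB ?natrX // expn_gt0 ltnW.
have W := congr1 (fun k => k%:R : rat) (weight_fibre_card g c).
rewrite !natrD !natrM Dn in W.
have -> : Q * D%:R * (hamming_weight (cw g c))%:R
    = Q * (Q ^+ m - 1 + (c == 0)%:R) - Q * (A g (- c))%:R by rewrite -W; ring.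
rewrite /scaled_weight; case: (eqVneq c 0) => [->|c0].
  have h0 := congr1 (fun k => k%:~R : rat)
    (fibre_card0E mE card_ext tr_sum prim_a g).
  rewrite rmorphD !rmorphM /= Ncast q1cast -!pmulrn -/Q in h0.
  by rewrite oppr0 h0 -/(sigma g) mulr1n; ring.
have h1 := congr1 (fun k => k%:~R : rat)
  (fibre_card1E mE card_ext tr_sum prim_a g).
rewrite rmorphB !rmorphM /= Ncast -!pmulrn -/Q in h1.
have nc0 : - c != 0 by rewrite oppr_eq0.
rewrite (fibre_card_neq0 mE card_ext tr_sum prim_a g nc0) h1.
by rewrite -/(sigma g) mulr0n; ring.
Qed.


Let h := m./2.
Let P : rat := Q ^+ e.
Let Y : rat := Q ^+ h.

Let hE : h = (e * s)%N.
Proof. by rewrite /h mE -mulnA mul2n doubleK. Qed.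

Let QmE : Q ^+ m = Y * Y.
Proof. by rewrite -exprD addnn hE -mul2n mulnA -mE. Qed.

(* The values [(- p) ^ s] and [(- p) ^ (s + 1)] of the exponential sums. *)
Let x1 : rat := (-1) ^+ s * Y.
Let x2 : rat := (-1) ^+ s.+1 * (Y * P).

Let sigma_cast k : ((- (q ^ e)%N%:Z) ^+ k)%:~R = (-1) ^+ k * Q ^+ (e * k) :> rat.
Proof. by rewrite rmorphXn rmorphN /= -pmulrn natrX [LHS]exprNn -exprM. Qed.

Lemma sigma0 : sigma 0 = Q ^+ m.
Proof.
rewrite /sigma /exp_sum !(fibre_card_g0 e tr_sum) eqxx oner_eq0 subr0.
by rewrite -pmulrn card_ext natrX.
Qed.

Let x1E : ((- (q ^ e)%N%:Z) ^+ s)%:~R = x1.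
Proof. by rewrite sigma_cast -hE. Qed.

Let x2E : ((- (q ^ e)%N%:Z) ^+ s.+1)%:~R = x2.
Proof. by rewrite sigma_cast mulnS addnC -hE exprD. Qed.

Lemma sigma_neq0 g : g != 0 -> sigma g = x1 \/ sigma g = x2.
Proof.
move=> /(exp_sum_neq0 mE e_gt0 card_ext tr_sum prim_a)[] Sg; [left|right].
  by rewrite /sigma Sg x1E.
by rewrite /sigma Sg x2E.
Qed.

Lemma sum_sigma (f : rat -> nat) :
  (\sum_(g : T | g != 0%R) f (sigma g) = n * q ^ e * f x1 + n * f x2)%N.
Proof.
have := sum_over_exp_sum mE e_gt0 card_ext tr_sum prim_a (fun k => f k%:~R).
by rewrite predNE x1E x2E.
Qed.

Lemma sigma_attained x : x = x1 \/ x = x2 -> exists2 g, g != 0 & sigma g = x.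
Proof.
move=> x12; have : (0 < \sum_(g : T | g != 0%R) (sigma g == x))%N.
  rewrite (sum_sigma (fun y => y == x)) addn_gt0 !muln_gt0 n_gt0.
  by rewrite expn_gt0 (ltnW q_gt1) !lt0b /=; case: x12 => ->; rewrite eqxx ?orbT.
rewrite lt0n sum_nat_eq0 negb_forall => /existsP[g].
by rewrite negb_imply eqb0 negbK => /andP[g0 /eqP]; exists g.
Qed.

Let Q_ge2 : 2 <= Q. Proof. by rewrite /Q ler_nat. Qed.

Let P_geQ : Q <= P.
Proof. by rewrite /P -[leLHS]expr1 ler_weXn2l // (le_trans _ Q_ge2). Qed.

Let Y_geP2 : P * P <= Y.
Proof.
rewrite /P -exprD ler_weXn2l ?(le_trans _ Q_ge2) // hE addnn -mul2n mulnC.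
by rewrite leq_mul2l s_gt1 orbT.
Qed.

Let QD_gt0 : 0 < Q * D%:R.
Proof. by rewrite mulr_gt0 ?ltr0n // ltnW. Qed.

(* For [c = 0] the weight decreases with the exponential sum, so the minimum is
   at the positive one of the two values. *)
Let xmax : rat := if odd s then Y * P else Y.

Lemma scaled_weight_C_min x : x = x1 \/ x = x2 ->
  0 < scaled_weight xmax 0 <= scaled_weight x 0.
Proof.
rewrite /scaled_weight eqxx /xmax /x1 /x2 QmE exprS -signr_odd mulN1r.
case: (weight_bounds Q_ge2 P_geQ Y_geP2) => Y4 YQ b1 b2 [b3 b4 b5 b6].
by case: (odd s); rewrite ?expr0 ?expr1 => -[]->; apply/andP; split; lra.
Qed.

(* For [c <> 0] the weight increases with the exponential sum.  The value of
   larger absolute value, [x2], decides: it is positive for odd [s], which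
   favours [c = 0], and negative for even [s], which favours [c <> 0]. *)
Let min_C0 : rat :=
  if odd s then scaled_weight (Y * P) 0 else scaled_weight (- (Y * P)) 1.

(** The second alternative in the hypothesis is that of the nonzero constant
    words, whose exponential sum is [q ^ m]. *)
Lemma scaled_weight_C0_min x c :
  (x = x1 \/ x = x2) \/ x = Q ^+ m /\ c != 0 ->
  0 < min_C0 <= scaled_weight x c.
Proof.
rewrite /min_C0 /scaled_weight eqxx oner_eq0 /x1 /x2 QmE exprS -signr_odd mulN1r.
have Q2 := Q_ge2.
case: (weight_bounds Q_ge2 P_geQ Y_geP2) => Y4 YQ b1 b2 [b3 b4 b5 b6].
case: (odd s); rewrite ?expr0 ?expr1 => -[[]->|[-> /negPf->]];
  try case: (c == 0); apply/andP; split; lra.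
Qed.


Lemma weight_eq (g : T) c :
  (hamming_weight (cw g c))%:R = scaled_weight (sigma g) c / (Q * D%:R).
Proof. by rewrite -weightE mulrC mulKf // lt0r_neq0. Qed.

Lemma codeword_weight_min (g : T) c : (g, c) != 0 ->
  0 < min_C0 <= Q * D%:R * (hamming_weight (cw g c))%:R.
Proof.
move=> gc0; rewrite weightE; apply: scaled_weight_C0_min.
have [g0|/sigma_neq0] := eqVneq g 0; last by left.
right; rewrite g0 sigma0; split=> //.
by apply: contraNneq gc0 => ->; rewrite g0.
Qed.

(** A zero codeword would have weight 0, below the positive minimum. *)
Lemma codeword_eq0 (g : L) c : cw g c = 0 -> g = 0 /\ c = 0.
Proof.
move=> gc; apply/pair_equal_spec/eqP; apply: contraT => /codeword_weight_min.
rewrite gc hamming_weight0 mulr0 => /andP[lt0 /(lt_le_trans lt0)].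
by rewrite ltxx.
Qed.

Lemma codeword00 : cw 0 0 = 0.
Proof.
apply/rowP=> i; have := codewordE 0 0 i => ->.
by rewrite mul0r (tr0 tr_sum) addr0 mxE.
Qed.

Lemma leq_weight (g g' : T) c c' :
    scaled_weight (sigma g) c <= scaled_weight (sigma g') c' ->
  (hamming_weight (cw g c) <= hamming_weight (cw g' c'))%N.
Proof. by rewrite -!weightE ler_pM2l // ler_nat. Qed.

Lemma is_code_code_C : exists2 d : nat,
  d%:R = scaled_weight xmax 0 / (Q * D%:R) & is_code (code_C n l (a : L)) m d.
Proof.
have xmax12 : xmax = x1 \/ xmax = x2.
  rewrite /xmax /x1 /x2 exprS -signr_odd mulN1r.
  by case: (odd s); [right|left]; rewrite ?opprK mul1r.
have [g g0 gx] := sigma_attained xmax12.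
exists (hamming_weight (cw g 0)); first by rewrite weight_eq gx.
apply: is_codeI; first exact: code_C_vspace codeword_eq0.
  exists (cw g 0); first exact: imset_f.
  by split=> //; apply: contraNneq g0 => /codeword_eq0[->].
move=> _ /imsetP[g' _ ->] u0; apply: leq_weight; rewrite gx.
have g'0 : (g' : T) != 0 by apply: contraNneq u0 => ->; rewrite codeword00.
by have /andP[] := scaled_weight_C_min (sigma_neq0 g'0).
Qed.

Lemma is_code_code_C0 : exists2 d : nat,
  d%:R = min_C0 / (Q * D%:R) & is_code (code_C0 n l (a : L)) (m + 1) d.
Proof.
have [g [c [gc0 gx]]] : exists g : T, exists c : F,
    (g, c) != 0 /\ scaled_weight (sigma g) c = min_C0.
  rewrite /min_C0; have [od|ev] := boolP (odd s).
    have [|g g0 gx] := @sigma_attained (Y * P).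
      by right; rewrite /x2 exprS -signr_odd od mulN1r opprK mul1r.
    by exists g, 0; rewrite gx; split=> //; apply: contraNneq g0 => -[->].
  have [|g g0 gx] := @sigma_attained (- (Y * P)).
    by right; rewrite /x2 exprS -signr_odd (negPf ev) mulN1r mulNr mul1r.
  by exists g, 1; rewrite gx; split=> //; apply: contraNneq g0 => -[->].
exists (hamming_weight (cw g c)); first by rewrite weight_eq gx.
apply: is_codeI; first exact: code_C0_vspace codeword_eq0.
  exists (cw g c); first exact: imset2_f.
  by split=> //; apply: contraNneq gc0 => /codeword_eq0[-> ->].
move=> _ /imset2P[g' c' _ _ ->] u0; apply: leq_weight; rewrite gx.
have gc'0 : ((g' : T), c') != 0.
  by apply: contraNneq u0 => -[-> ->]; rewrite codeword00.
by have /andP[_] := codeword_weight_min gc'0; rewrite weightE.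
Qed.

Let sum_weight c w :
  (\sum_(g : T | g != 0%R) ((hamming_weight (cw g c))%:R == w :> rat)
   = n * q ^ e * (scaled_weight x1 c / (Q * D%:R) == w)
     + n * (scaled_weight x2 c / (Q * D%:R) == w))%N.
Proof.
rewrite -(sum_sigma (fun x => scaled_weight x c / (Q * D%:R) == w)).
by apply: eq_bigr => g _; rewrite weight_eq.
Qed.

Let weight_list : seq (rat * nat) :=
  [:: (0, 1%N); (scaled_weight x2 0 / (Q * D%:R), n);
      (scaled_weight x1 0 / (Q * D%:R), (n * q ^ e)%N)].

Let weight_list0 : seq (rat * nat) :=
  [:: (scaled_weight (Q ^+ m) 1 / (Q * D%:R), (q - 1)%N);
      (scaled_weight x2 1 / (Q * D%:R), (n * (q - 1))%N);
      (scaled_weight x1 1 / (Q * D%:R), (n * q ^ e * (q - 1))%N)].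

Let sum_weight_list w :
  (\sum_(g : T) ((hamming_weight (cw g 0%R))%:R == w :> rat)
    = \sum_(p <- weight_list | p.1 == w) p.2)%N.
Proof.
rewrite (bigD1 0) //= sum_weight codeword00 hamming_weight0.
rewrite /weight_list !sum_freq_cons big_nil addn0 mul1n.
by congr (_ + _)%N; rewrite addnC.
Qed.

Lemma weight_distribution_code_C :
  has_weight_distribution (code_C n l (a : L)) weight_list.
Proof.
move=> w; rewrite -sum_weight_list card_imset_weight // => g g'.
by case/(codeword_inj codeword_eq0).
Qed.

Lemma weight_distribution_code_C0 :
  has_weight_distribution (code_C0 n l (a : L)) (weight_list ++ weight_list0).
Proof.
move=> w; pose f (x : T * F) := cw x.1 x.2.
have -> : code_C0 n l (a : L) = [set f x | x : T * F].
  apply/setP=> u; apply/imset2P/imsetP=> [[g c _ _ ->]|[[g c] _ ->]].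
    by exists (g, c).
  by exists g c.
rewrite card_imset_weight => [|[g c] [g' c'] /(codeword_inj codeword_eq0)[/= -> ->]//].
rewrite big_cat /= -sum_weight_list.
rewrite -(pair_bigA _ (fun (g : T) (c : F) =>
  (hamming_weight (cw g c))%:R == w :> rat : nat)) /=.
(* The words with [c = 0] make up the smaller code; each of the [q - 1] other
   values of [c] contributes the same amount. *)
rewrite exchange_big (bigD1 0) //=; congr (_ + _)%N.
rewrite (eq_bigr (fun=> \sum_(g : T) ((hamming_weight (cw g 1%R))%:R == w :> rat))%N).
  rewrite sum_nat_cond_const cardsE (cardC1 (0 : F)) (bigD1 0) //= sum_weight.
  rewrite weight_eq sigma0 /weight_list0 !sum_freq_cons big_nil addn0 -subn1.
  rewrite !mulnDr; congr (_ + _)%N.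
  by rewrite /= addnC ![((q - 1) * (_ * _))%N]mulnCA !mulnA.
move=> c c0; apply: eq_bigr => g _; rewrite !weight_eq /scaled_weight.
by rewrite (negPf c0) oner_eq0.
Qed.

Let formulas : [/\ min_dist_C q m l = scaled_weight xmax 0 / (Q * D%:R),
  min_dist_C0 q m l = min_C0 / (Q * D%:R),
  weights_C q m l = weight_list
  & weights_C0 q m l = weight_list ++ weight_list0].
Proof.
have Q0 : Q != 0 by rewrite lt0r_neq0 // (lt_le_trans _ Q_ge2).
have D0 : (D%:R : rat) != 0 by rewrite pnatr_eq0 -lt0n.
have expB k : (0 < k)%N -> Q ^+ (k - 1) = Q ^+ k / Q.
  by move=> k_gt0; rewrite -[in RHS](subnK k_gt0) exprD expr1 mulfK.
have h_gt0 : (0 < h)%N by rewrite hE muln_gt0 e_gt0 ltnW.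
have he1 : Q ^+ (h + e - 1) = Y * P / Q.
  by rewrite expB ?exprD // addn_gt0 h_gt0.
rewrite /weights_C0 /weights_C /min_dist_C /min_dist_C0 /weight_list /weight_list0.
rewrite /min_C0 /xmax /scaled_weight eqxx oner_eq0 -/Q -/D -/n -/e -/h -/s.
rewrite !addn1 !exprS he1 !expB // -/Y -/P QmE /x1 /x2 !exprS.
split.
- by case: (odd s); field; rewrite ?D0.
- by case: (odd s); field; rewrite ?D0.
- by congr [:: _; (_, _); (_, _)]; field; rewrite ?D0.
- by congr [:: _; (_, _); (_, _); (_, _); (_, _); (_, _)]; field; rewrite ?D0.
Qed.

Lemma two_weight_codes :
  [/\ exists2 d : nat, d%:R = min_dist_C q m l
        & is_code (code_C n l (a : L)) m d,
      exists2 d : nat, d%:R = min_dist_C0 q m l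
        & is_code (code_C0 n l (a : L)) (m + 1) d,
      has_weight_distribution (code_C n l (a : L)) (weights_C q m l)
    & has_weight_distribution (code_C0 n l (a : L)) (weights_C0 q m l)].
Proof.
case: formulas => -> -> -> ->; split.
- exact: is_code_code_C.
- exact: is_code_code_C0.
- exact: weight_distribution_code_C.
- exact: weight_distribution_code_C0.
Qed.

End Weights.

Theorem theorem4p1 (q m l : nat) (F : finFieldType) (L : splittingFieldType F)
    (alpha : {unit (finvect_type L)})
    (hq : #|F| = q) (hm : \dim {:L} = m)
    (halpha : generator [set: {unit (finvect_type L)}] alpha)
    (m_gt0 : (0 < m)%N) (l_gt0 : (0 < l)%N) (hlm : (2 * l < m)%N)
    (hml : ~~ odd (m %/ gcdn m l)) :
  let n := code_len q m l in
  let C := code_C n l (FinRing.uval alpha : L) in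
  let C0 := code_C0 n l (FinRing.uval alpha : L) in
  [/\ exists2 d : nat, d%:R = min_dist_C q m l & is_code C m d,
      exists2 d : nat, d%:R = min_dist_C0 q m l & is_code C0 (m + 1) d,
      has_weight_distribution C (weights_C q m l)
    & has_weight_distribution C0 (weights_C0 q m l)].
Proof.
by subst q m; apply: two_weight_codes.
Qed.
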